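(* Let $a=(a_i)_{i\in\mathbb Z}$ be a sequence in $\Bbbk$. For any composition $I=(i_1,\ldots,i_n)$ with conjugate composition $I^\sim=(j_1,\ldots,j_m)$, $$R_{I;a}^{[i_n-1]}=(-1)^{m-1}|C|_{1m},$$ where $C$ is the $m\times m$ matrix $$C=\begin{pmatrix} \Lambda_{j_m;a}^{[t_1]}&\Lambda_{j_{m-1}+j_m;a}^{[t_{2}]}&\cdots&\Lambda_{j_2+\cdots +j_{m};a}^{[t_{m-1}]}&\Lambda_{j_1+\cdots +j_{m};a}\\ 1&\Lambda_{j_{m-1};a}^{[t_{2}]}&\cdots&\Lambda_{j_2+\cdots+j_{m-1};a}^{[t_{m-1}]}&\Lambda_{j_1+\cdots+j_{m-1};a}\\ 0&\ddots&\ddots&\vdots&\vdots\\ \vdots&\cdots&\ddots&\Lambda_{j_{2};a}^{[t_{m-1}]}&\Lambda_{j_{1}+j_2;a}\\ 0&\cdots&\cdots&1&\Lambda_{j_1;a} \end{pmatrix},$$ i.e. $C_{pq}=\Lambda_{j_{m+1-q}+\cdots+j_{m+1-p};a}^{[t_q]}$ for $p\le q$, $C_{q+1,q}=1$, $C_{pq}=0$ for $p>q+1$, with $t_k=\sum_{\nu=1}^{m-k}j_\nu$ (so $t_m=0$).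
   Context: $\Bbbk$ is a field of characteristic zero and $a=(a_i)_{i\in\mathbb Z}$ is a sequence in $\Bbbk$. Put $(t\downarrow a)^k=(t-a_1)\cdots(t-a_k)$, $(t\downarrow a)^0=1$, $(\tau^s a)_i=a_{i+s}$ for $s\in\mathbb Z$, and $\hat a_i=-a_{-i+1}$. $\mathrm{Sym}^a=\Bbbk\langle S_{1;a},S_{2;a},\ldots\rangle$ is the free associative unital $\Bbbk$-algebra on $S_{k;a}$, $k\ge1$. With $t$ a central variable and all expressions expanded as formal power series in $1/t$, put $\sigma^a(t)=\sum_{k\ge0}S_{k;a}/(t\downarrow a)^k$ and $\lambda^{\hat a}(t)=\sum_{k\ge0}\Lambda_{k;a}/(t\downarrow\hat a)^k$ with $S_{0;a}=\Lambda_{0;a}=1$; the elements $\Lambda_{k;a}\in\mathrm{Sym}^a$ are determined by $\lambda^{\hat a}(-t)\sigma^a(t)=\sigma^a(t)\lambda^{\hat a}(-t)=1$. Shifts: for $s\in\mathbb Z$, $S_{k;a}^{[s]}$ and $\Lambda_{k;a}^{[s]}$ are defined by $\sum_{k\ge0} S_{k;a}^{[s]}/(t\downarrow\tau^{-s}a)^k=\sum_{k\ge0}S_{k;a}/(t\downarrow a)^k$ and $\sum_{k\ge0}\Lambda_{k;a}^{[s]}/(t\downarrow\tau^{s}\hat a)^k=\sum_{k\ge0}\Lambda_{k;a}/(t\downarrow\hat a)^k$. Quasideterminants: for an $n\times n$ matrix $A$ over a unital ring such that the matrix $A^{pq}$ (delete row $p$ and column $q$) is invertible, $|A|_{pq}=a_{pq}-r(A^{pq})^{-1}c$,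 where $r$ is the $p$-th row of $A$ with $a_{pq}$ removed and $c$ is the $q$-th column of $A$ with $a_{pq}$ removed. A composition is a sequence $I=(i_1,\ldots,i_n)$ of positive integers. For $K=(k_1,\ldots,k_n)\in\mathbb Z^n$ set $R_{I;a}^{[K]}=(-1)^{n-1}|M|_{1n}$, where $M_{pq}=S_{i_p+\cdots+i_q;a}^{[k_p]}$ if $p\le q$, $M_{q+1,q}=1$, $M_{pq}=0$ if $p>q+1$. With $s_k=\sum_{\nu=k}^{n-1}i_\nu$, $R_{I;a}=R_{I;a}^{[(s_1,\ldots,s_{n-1},0)]}$ and, for $s\in\mathbb Z$, $R_{I;a}^{[s]}=R_{I;a}^{[(s_1+s,\ldots,s_{n-1}+s,s)]}$. Conjugate composition: the ribbon diagram of $I$ has $i_l$ boxes in its $l$-th row (rows numbered from top to bottom), the first box of row $l+1$ lying directly below the last box of row $l$. $I^\sim=(j_1,\ldots,j_m)$ is the sequence of column heights of this diagram read from right to left (e.g. $(2,1,1)^\sim=(3,1)$, $(1,3,2,1)^\sim=(2,2,1,2)$). *)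

(* Defs.v *)
From HB Require Import structures.
From mathcomp Require Import all_boot all_order all_algebra.
From mathcomp Require Import boolp classical_sets.
From mathcomp Require finmap.
From mathcomp Require Import monalg.

Set Implicit Arguments.
Unset Strict Implicit.
Unset Printing Implicit Defensive.

Import GRing.Theory.
Local Open Scope ring_scope.

Section TriangularRecursion.

Variable V : nmodType.

(* [tri F] is the sequence c with c n = F n c, when F n c only depends on
   c 0, ..., c (n - 1); see [triE]. *)
Fixpoint tri_seq (F : nat -> (nat -> V) -> V) (n : nat) : seq V :=
  if n is m.+1 then rcons (tri_seq F m) (F m (nth 0 (tri_seq F m))) else [::].

Definition tri (F : nat -> (nat -> V) -> V) (n : nat) : V :=
  F n (nth 0 (tri_seq F n)).

Lemma size_tri_seq F n : size (tri_seq F n) = n.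
Proof. by elim: n => //= n IHn; rewrite size_rcons IHn. Qed.

Lemma nth_tri_seq F n i : (i < n)%N -> nth 0 (tri_seq F n) i = tri F i.
Proof.
elim: n => //= n IHn; rewrite ltnS nth_rcons size_tri_seq => le_in.
by case: ltngtP le_in => // [/IHn //|->].
Qed.

Lemma triE F :
  (forall n c c', (forall i, (i < n)%N -> c i = c' i) -> F n c = F n c') ->
  forall n, tri F n = F n (tri F).
Proof. by move=> locF n; apply: locF => i; apply: nth_tri_seq. Qed.

End TriangularRecursion.

(* A sequence f : nat -> R stands for the formal power series
   \sum_n f n * t ^- n in 1 / t, the variable t being central. *)
Section Series.

Variable R : nzRingType.
Implicit Types f g h : nat -> R.

Definition series1 : nat -> R := fun n => (n == 0%N)%:R.

Definition seriesM f g : nat -> R := fun n => \sum_(i < n.+1) f i * g (n - i)%N.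

(* f(-t) *)
Definition seriesN f : nat -> R := fun n => (-1) ^+ n * f n.

(* The inverse of f when f 0 = 1, see [seriesVM] and [seriesMV]. *)
Definition seriesV f : nat -> R :=
  tri (fun n c => series1 n - \sum_(i < n) c i * f (n - i)%N).

Lemma seriesVE f n :
  seriesV f n = series1 n - \sum_(i < n) seriesV f i * f (n - i)%N.
Proof.
rewrite /seriesV triE // => {}n c c' eq_c.
by congr (_ - _); apply: eq_bigr => i _; rewrite eq_c.
Qed.

Lemma seriesVM f : f 0%N = 1 -> seriesM (seriesV f) f =1 series1.
Proof.
move=> f0 n; rewrite /seriesM big_ord_recr /= subnn f0 mulr1 seriesVE.
by rewrite addrC subrK.
Qed.

Lemma seriesM_poly N f g n : (n < N)%N ->
  seriesM f g n = ((\poly_(i < N) f i) * (\poly_(i < N) g i))`_n.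
Proof.
move=> lt_nN; rewrite coefM; apply: eq_bigr => i _.
rewrite !coef_poly (leq_ltn_trans _ lt_nN) ?(leq_ltn_trans _ lt_nN) //.
  exact: leq_subr.
by rewrite -ltnS.
Qed.

Lemma eq_seriesM f f' g g' : f =1 f' -> g =1 g' -> seriesM f g =1 seriesM f' g'.
Proof. by move=> ef eg n; apply: eq_bigr => i _; rewrite ef eg. Qed.

Lemma seriesMA f g h : seriesM f (seriesM g h) =1 seriesM (seriesM f g) h.
Proof.
move=> n; rewrite !(@seriesM_poly n.+1) //.
pose P f := \poly_(i < n.+1) f i.
have E (u v w : {poly R}) : (forall i, (i <= n)%N -> u`_i = v`_i) ->
    (u * w)`_n = (v * w)`_n /\ (w * u)`_n = (w * v)`_n.
  move=> uv; rewrite !coefM; split; apply: eq_bigr => i _; rewrite uv //.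
    by rewrite -ltnS.
  exact: leq_subr.
rewrite (E _ (P g * P h) _ _).2 ?mulrA; last first.
  by move=> i le_in; rewrite coef_poly ltnS le_in -seriesM_poly.
rewrite (E (\poly_(i < _) _) (P f * P g) _ _).1 //.
by move=> i le_in; rewrite coef_poly ltnS le_in -seriesM_poly.
Qed.

Lemma seriesM1 f : seriesM f series1 =1 f.
Proof.
move=> n; rewrite /seriesM big_ord_recr /= /series1 subnn mulr1 big1 ?add0r //.
by move=> i _; rewrite subn_eq0 leqNgt ltn_ord mulr0.
Qed.

Lemma series1M f : seriesM series1 f =1 f.
Proof.
move=> n; rewrite /seriesM big_ord_recl /= /series1 subn0 mul1r big1 ?addr0 //.
by move=> i _; rewrite mul0r.
Qed.

Lemma seriesV0 f : seriesV f 0%N = 1.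
Proof. by rewrite seriesVE big_ord0 subr0. Qed.

Lemma seriesMV f : f 0%N = 1 -> seriesM f (seriesV f) =1 series1.
Proof.
move=> f0 n; pose g := seriesV f.
have gK := seriesVM f0; have gK' : seriesM (seriesV g) g =1 series1.
  by apply: seriesVM; apply: seriesV0.
rewrite -[RHS]gK' (_ : seriesM f g n = seriesM (seriesV g) g n) //.
apply: eq_seriesM => // {n}n.
rewrite -series1M -(eq_seriesM gK' (frefl _)) -seriesMA.
by rewrite (eq_seriesM (frefl _) gK) seriesM1.
Qed.

Lemma seriesNK f : seriesN (seriesN f) =1 f.
Proof. by move=> n; rewrite /seriesN mulrA -expr2 sqrr_sign mul1r. Qed.

End Series.

Section DoubleFactorialSeries.

Variable K : fieldType.
Implicit Types (a b : int -> K) (s : int) (k n : nat).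

Definition tau s a : int -> K := fun i => a (i + s).

Definition hat a : int -> K := fun i => - a (- i + 1).

Lemma tau0 a : tau 0 a = a.
Proof. by apply: funext => i; rewrite /tau addr0. Qed.

(* 1 / (t - x) = \sum_m x ^+ m * t ^- m.+1 *)
Definition inv_linear (x : K) : nat -> K :=
  fun n => if n is m.+1 then x ^+ m else 0.

(* 1 / (t \downarrow b)^k = \prod_(1 <= i <= k) 1 / (t - b i) *)
Fixpoint inv_dfact b k : nat -> K :=
  if k is k'.+1 then seriesM (inv_dfact b k') (inv_linear (b k%:Z))
  else series1 K.

Lemma inv_linearP (x : K) :
  inv_linear x 0%N = 0 /\
  forall n, inv_linear x n.+1 - x * inv_linear x n = (n == 0%N)%:R.
Proof.
split=> // -[|n] /=; first by rewrite mulr0 subr0.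
by rewrite -exprS subrr.
Qed.

Lemma inv_dfact_tri b k n : (n <= k)%N -> inv_dfact b k n = (n == k)%:R.
Proof.
elim: k n => [|k IHk] n /=; first by [].
case: n => [|n] le_nk; rewrite /seriesM.
  by rewrite big_ord1 mulr0.
rewrite big_ord_recr /= subnn mulr0 addr0 big_ord_recr /= subSnn /= expr0 mulr1.
rewrite big1 ?add0r => [|i _]; first by rewrite IHk.
rewrite IHk; last by rewrite (leq_trans (ltnW (ltn_ord i))).
by rewrite ltn_eqF ?mul0r // (leq_trans (ltn_ord i)).
Qed.

Variable V : lmodType K.
Implicit Types c f : nat -> V.

(* The expansion in 1 / t of \sum_k c k / (t \downarrow b)^k; the sum is finite
   in each degree because 1 / (t \downarrow b)^k has order k. *)
Definition dfseries b c : nat -> V :=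
  fun n => \sum_(k < n.+1) inv_dfact b k n *: c k.

(* The unique c such that dfseries b c = f, see [dfcoefK] and [dfseriesK]. *)
Definition dfcoef b f : nat -> V :=
  tri (fun n c => f n - \sum_(k < n) inv_dfact b k n *: c k).

Lemma dfcoefK b f : dfseries b (dfcoef b f) =1 f.
Proof.
move=> n; rewrite /dfseries big_ord_recr /= inv_dfact_tri // eqxx scale1r.
rewrite {2}/dfcoef triE 1?addrC ?subrK // => {}n c c' eq_c.
by congr (_ - _); apply: eq_bigr => i _; rewrite eq_c.
Qed.

Lemma dfseries_inj b c c' : dfseries b c =1 dfseries b c' -> c =1 c'.
Proof.
move=> eq_s n; elim/ltn_ind: n => n IHn; have := eq_s n.
rewrite /dfseries !big_ord_recr /= inv_dfact_tri // eqxx !scale1r.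
rewrite (eq_bigr (fun i : 'I_n => inv_dfact b i n *: c' i)) => [/addrI //|i _].
by rewrite IHn.
Qed.

Lemma dfseriesK b c : dfcoef b (dfseries b c) =1 c.
Proof. by apply: (@dfseries_inj b); apply: dfcoefK. Qed.

Lemma dfseries0 b c : dfseries b c 0%N = c 0%N.
Proof. by rewrite /dfseries big_ord1 scale1r. Qed.

End DoubleFactorialSeries.

(* The free associative unital K-algebra on countably many generators: the
   monoid algebra of the free monoid on nat. *)
Definition NSym (K : fieldType) := {malg K[{fmonom nat}]}.

HB.instance Definition _ (K : fieldType) := GRing.Lalgebra.on (NSym K).

Fact NSym_scalerAr (K : fieldType) (x : K) (u v : NSym K) :
  x *: (u * v) = u * (x *: v).
Proof.
rewrite malgME (malgMEw (finmap.fsubset_refl _) (msuppZ_le x v)).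
rewrite scaler_sumr; apply: eq_bigr => k1 _.
rewrite scaler_sumr; apply: eq_bigr => k2 _.
rewrite [(x *: v)@_k2]mcoeffZ [X in _ = << X *g _ >>]mulrCA.
by apply/malgP => m; rewrite mcoeffZ !mcoeffU mulrnAr.
Qed.

HB.instance Definition _ (K : fieldType) :=
  GRing.Lalgebra_isAlgebra.Build K (NSym K) (@NSym_scalerAr K).

Section NoncommutativeSymmetricFunctions.

Variables (K : fieldType) (a : int -> K).

(* S_{k;a}; the letter indexing S_{k;a} is k - 1, for k >= 1. *)
Definition Sgen (k : nat) : NSym K :=
  if k is k'.+1 then << fmu k' >> else 1.

Definition sigma : nat -> NSym K := dfseries a Sgen.

(* Lambda_{k;a}, defined by lambda^{\hat a}(-t) = sigma^a(t)^-1. *)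
Definition Lambda : nat -> NSym K :=
  dfcoef (hat a) (seriesN (seriesV sigma)).

Definition lambda : nat -> NSym K := dfseries (hat a) Lambda.

Definition Sshift (s : int) : nat -> NSym K := dfcoef (tau (- s) a) sigma.

Definition Lambda_shift (s : int) : nat -> NSym K :=
  dfcoef (tau s (hat a)) lambda.

Lemma LambdaP :
  [/\ Lambda 0%N = 1,
      seriesM (seriesN lambda) sigma =1 series1 _ &
      seriesM sigma (seriesN lambda) =1 series1 _].
Proof.
have s0 : sigma 0%N = 1 by rewrite /sigma dfseries0.
have lN : seriesN lambda =1 seriesV sigma.
  by move=> n; rewrite -[RHS]seriesNK /seriesN [lambda n]dfcoefK.
split.
- by rewrite -(dfseries0 (hat a) Lambda) dfcoefK /seriesN mul1r seriesV0.
- by move=> n; rewrite (eq_seriesM lN (frefl _)) seriesVM.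
- by move=> n; rewrite (eq_seriesM (frefl _) lN) seriesMV.
Qed.

Lemma SshiftP s : dfseries (tau (- s) a) (Sshift s) =1 dfseries a Sgen.
Proof. exact: dfcoefK. Qed.

Lemma Lambda_shiftP s :
  dfseries (tau s (hat a)) (Lambda_shift s) =1 dfseries (hat a) Lambda.
Proof. exact: dfcoefK. Qed.

Lemma Lambda_shift0 : Lambda_shift 0 =1 Lambda.
Proof. by move=> n; rewrite /Lambda_shift tau0 /lambda; apply: dfseriesK. Qed.

End NoncommutativeSymmetricFunctions.

Section Quasideterminants.

Variable R : nzRingType.

Definition is_mxinv n (A B : 'M[R]_n) : Prop :=
  A *m B = 1%:M /\ B *m A = 1%:M.

(* The two-sided inverse of A, with value 0 when there is none ([invmx] needs a
   commutative ring). *)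
Definition mxinv n (A : 'M[R]_n) : 'M[R]_n := xget 0 [set B | is_mxinv A B]%classic.

(* |A|_{pq}; meaningful when row' p (col' q A) is invertible. *)
Definition quasidet n (p q : 'I_n.+1) (A : 'M[R]_n.+1) : R :=
  A p q - (row p (col' q A) *m mxinv (row' p (col' q A)) *m col q (row' p A)) 0 0.

(* The matrices whose entries are h p q on and above the diagonal, 1 just below
   the diagonal and 0 further below; indices start at 0. *)
Definition hessenberg n (h : nat -> nat -> R) : 'M[R]_n.+1 :=
  \matrix_(p, q) if (p <= q)%N then h p q else if p == q.+1 :> nat then 1 else 0.

Lemma mxinvP n (A B : 'M[R]_n) : is_mxinv A B -> mxinv A = B.
Proof.
move=> [AB BA]; rewrite /mxinv; case: xgetP => [C _ [AC CA]|/(_ B)[]//].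
by rewrite -[C]mulmx1 -AB mulmxA CA mul1mx.
Qed.

Lemma unitriangular_inv n (U : 'M[R]_n) :
  (forall i j : 'I_n, (j <= i)%N -> U i j = (i == j)%:R) -> is_mxinv U (mxinv U).
Proof.
move=> Utri; suff [B BP] : exists B, is_mxinv U B.
  by rewrite (mxinvP BP).
elim: n U Utri => [|n IHn] U Utri.
  by exists 1%:M; split; apply/matrixP => - [].
have [|B [UB BU]] := IHn (drsubmx (U : 'M_(1 + n))).
  by move=> i j le_ji; rewrite !mxE Utri ?eq_rshift //= leq_add2l.
have Eul : ulsubmx (U : 'M_(1 + n)) = 1%:M.
  by apply/matrixP => i j; rewrite !ord1 !mxE Utri.
have Edl : dlsubmx (U : 'M_(1 + n)) = 0.
  by apply/matrixP => i j; rewrite ord1 !mxE Utri ?eq_rlshift // leq0n.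
have -> : U = block_mx 1%:M (ursubmx (U : 'M_(1 + n))) 0
                (drsubmx (U : 'M_(1 + n))).
  by rewrite -Eul -Edl submxK.
exists (block_mx 1%:M (- ursubmx (U : 'M_(1 + n)) *m B) 0 B).
split; apply: (etrans (@mulmx_block _ 1 n 1 n 1 n _ _ _ _ _ _ _ _));
  rewrite !(mulmx0, mul0mx, mul1mx, mulmx1, addr0, add0r) !mulNmx.
  by rewrite addNr UB -scalar_mx_block.
by rewrite -mulmxA BU mulmx1 subrr -scalar_mx_block.
Qed.

Lemma hessenberg_minor_inv n h (A := row' ord0 (col' ord_max (hessenberg n h))) :
  is_mxinv A (mxinv A).
Proof.
apply: unitriangular_inv => i j le_ji; rewrite !mxE lift0 lift_max.
rewrite leqNgt ltnS le_ji /= eqSS -val_eqE /=.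
by case: eqP.
Qed.

End Quasideterminants.

Definition is_composition (I : seq nat) : bool := (I != [::]) && (0%N \notin I).

Section RibbonDiagram.

Variable I : seq nat.

(* Rows and columns of the ribbon diagram are numbered from 0, from top to
   bottom and from left to right; row l starts in the last column of row
   l - 1, hence in column \sum_(nu < l) (i_nu - 1). *)
Definition row_start (l : nat) : nat :=
  sumn [seq i.-1 | i <- take l I].

Definition in_ribbon (l c : nat) : bool :=
  (l < size I)%N && (row_start l <= c < row_start l + nth 0 I l)%N.

Definition ribbon_width : nat := (row_start (size I)).+1.

Definition column_height (c : nat) : nat :=
  count (in_ribbon^~ c) (iota 0 (size I)).

Definition conjugate : seq nat :=
  rev [seq column_height c | c <- iota 0 ribbon_width].

End RibbonDiagram.

Example conjugate211 : conjugate [:: 2; 1; 1] = [:: 3; 1].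
Proof. by []. Qed.

Example conjugate1321 : conjugate [:: 1; 3; 2; 1] = [:: 2; 2; 1; 2].
Proof. by []. Qed.

Section Ribbons.

Variables (K : fieldType) (a : int -> K).

(* R_{I;a}^{[k]}, for k : nat -> int restricted to {0, ..., n - 1}. *)
Definition ribbonS_multi (I : seq nat) (k : nat -> int) : NSym K :=
  (-1) ^+ (size I).-1 *
  quasidet ord0 ord_max (hessenberg (size I).-1
    (fun p q => Sshift a (k p) (\sum_(p <= nu < q.+1) nth 0 I nu)%N)).

(* R_{I;a}^{[s]}, where s_{p+1} is the sum of nth 0 I nu, p <= nu < n - 1. *)
Definition ribbonS (I : seq nat) (s : int) : NSym K :=
  ribbonS_multi I
    (fun p => (\sum_(p <= nu < (size I).-1) nth 0 I nu)%N%:Z + s).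

(* The matrix C: in terms of 0-based indices p, q and nu, the argument of Lambda
   sums J over m - 1 - q <= nu <= m - 1 - p, and the shift sums J over
   0 <= nu < m - 1 - q. *)
Definition LambdaC (J : seq nat) : 'M[NSym K]_((size J).-1.+1) :=
  hessenberg (size J).-1
    (fun p q => Lambda_shift a (\sum_(0 <= nu < (size J).-1 - q) nth 0 J nu)%N%:Z
       (\sum_((size J).-1 - q <= nu < ((size J).-1 - p).+1) nth 0 J nu)%N).

End Ribbons.

(* Main.v *)
Require Import Defs.
From mathcomp Require Import all_boot all_order all_algebra.
From mathcomp Require boolp.
From mathcomp Require Import zify.
Import GRing.Theory.
Local Open Scope ring_scope.

(** Number the boxes of the ribbon 1, ..., N along the path from its first to
its last box, and let a cut mean a position between two consecutive boxes.
Expanding the quasideterminant of a Hessenberg matrix shows that both sides are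
alternating sums over sets T of allowed cuts, the term of T being the product,
over the blocks of boxes (u, v] that T delimits, of an entry that depends on
(u, v) only ([quasidet_ribbon], [ribbon_behead_word]). On the left the allowed
cuts are the row ends of the ribbon. On the right they are the column ends,
which are exactly the other positions ([word_columns]).

The entry s u v on the left is a coefficient of sigma, and the shift by
i_n - 1 makes its basis come from a single sequence b attached to the boxes:
sigma = \sum_v s u v / ((t - b_(u+1)) ... (t - b_v)). Hence, with
phi_u = 1 / ((t - b_1) ... (t - b_u)), s is the matrix of multiplication by
sigma in the basis (phi_u). The entry e u v on the right is, up to the sign
(-1)^(v-u), a coefficient of sigma^-1 in a basis built from
b_(v-1), b_(v-2), ... The k-th coefficient depends only on the unordered
collection of the first k - 1 parameters, because it is the residue of the
series times (t - b_1) ... (t - b_(k-1)) ([dfcoef_rev]); so these parameters may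
be read in the opposite order, and (-1)^(v-u) e u v becomes the (u, v) entry of
the matrix of multiplication by sigma^-1. The product rule [dfcoefM] says that
the two matrices are inverse to each other ([box_signed_inverse]).

What remains holds for every unitriangular matrix s and its inverse up to signs
e: complementing the set of allowed cuts exchanges the alternating sums of s
and e ([ribbon_dual]). Allowing one more cut replaces the sum F by the product
of the sums of the two parts minus F, on the s side, and forbidding that cut
does the same on the e side; this reduces the claim to one row without cuts,
which is the formula for the inverse of a unitriangular matrix. *)

Set Implicit Arguments.
Unset Strict Implicit.

(** * Alternating sums over coarsenings *)

Lemma nseq_catr (T : Type) n (x : T) (l : seq T) :
  nseq n x ++ x :: l = nseq n.+1 x ++ l.
Proof. by elim: n => //= n ->. Qed.

Section RibbonSums.

Variable R : nzRingType.
Implicit Types (h s e : nat -> nat -> R) (u v : nat) (d : seq bool).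

(** The boxes of a ribbon being processed from left to right, the current block
is (u, v], and d tells, for the position after box v and for each later one,
whether a cut is allowed there. Making the cut closes the block; not making it
changes the sign. *)
Fixpoint ribbon h u v d : R :=
  match d with
  | [::] => h u v
  | true :: d' => h u v * ribbon h v v.+1 d' - ribbon h u v.+1 d'
  | false :: d' => ribbon h u v.+1 d'
  end.

Lemma eq_ribbon h h' u v d : (u < v)%N ->
  (forall x y, (x < y <= v + size d)%N -> h x y = h' x y) ->
  ribbon h u v d = ribbon h' u v d.
Proof.
elim: d u v => [|x d IHd] u v lt_uv eq_h /=;
  first by apply: eq_h; rewrite /=; lia.
have eq_h' y z : (y < z <= v.+1 + size d)%N -> h y z = h' y z.
  by move=> yz; apply: eq_h; rewrite /= addnS.
by case: x eq_h => eq_h; rewrite !(IHd _ _ _ eq_h') ?eq_h /=; try lia.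
Qed.

Lemma ribbon_nseq_false h u v k d :
  ribbon h u v (nseq k false ++ d) = ribbon h u (v + k) d.
Proof. by elim: k v => [|k IHk] v /=; rewrite ?addn0 ?IHk ?addSnnS. Qed.

(** A sum where one given cut is allowed is the difference between the terms
that use it, which factor, and those that do not. *)
Lemma ribbon_cat h u v d d' :
  ribbon h u v (d ++ true :: d') + ribbon h u v (d ++ false :: d') =
  ribbon h u v d * ribbon h (v + size d) (v + size d).+1 d'.
Proof.
elim: d u v => [|x d IHd] u v /=; first by rewrite addn0 subrK.
rewrite -addSnnS; case: x; last exact: IHd.
by rewrite mulrBl -mulrA -!IHd mulrDr opprD addrACA.
Qed.

(** Sort the terms by their first block. *)
Lemma ribbon_nseq_true h u v k :
  ribbon h u v (nseq k true) =
  \sum_(i < k) (-1) ^+ i *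
     (h u (v + i)%N * ribbon h (v + i) (v + i).+1 (nseq (k - i.+1) true))
  + (-1) ^+ k * h u (v + k)%N.
Proof.
elim: k v => [|k IHk] v /=; first by rewrite big_ord0 add0r mul1r addn0.
rewrite big_ord_recl mul1r addn0 subn1 /= IHk -addrA opprD; congr (_ + (_ + _)).
  rewrite -sumrN; apply: eq_bigr => i _.
  by rewrite -mulNr -mulN1r -exprS addSnnS.
by rewrite -mulNr -mulN1r -exprS addSnnS.
Qed.

(** Where u <= v, s and (u, v) |-> (-1)^(v-u) e u v are inverse unitriangular
matrices. *)
Definition signed_inverse s e :=
  [/\ forall v, s v v = 1, forall v, e v v = 1 &
   forall u v, (u < v)%N ->
     \sum_(i < (v - u).+1) (-1) ^+ i * (e u (u + i)%N * s (u + i)%N v) = 0].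

(** Expanding along the first block and using induction on the rest, this is the
relation between s and e solved for its term s u v. *)
Lemma ribbon_nseq_true_inv s e u k : signed_inverse s e ->
  ribbon e u u.+1 (nseq k true) = s u (u.+1 + k)%N.
Proof.
case=> s1 e1 es0; elim/ltn_ind: k u => k IHk u.
have := es0 u (u.+1 + k)%N; rewrite addSnnS => /(_ ltac:(lia)).
rewrite addKn big_ord_recl mul1r addn0 e1 mul1r.
move/eqP; rewrite addr_eq0 => /eqP ->.
rewrite big_ord_recr ribbon_nseq_true /= opprD -sumrN s1 mulr1.
rewrite /bump /= add1n addSnnS exprS mulN1r mulNr opprK; congr (_ + _).
apply: eq_bigr => -[i /= lt_ik] _.
rewrite /bump /= add1n IHk; last by lia.
rewrite exprS mulN1r mulNr opprK addSnnS; congr (_ * (_ * s _ _)); lia.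
Qed.

(** On the left the current block (u, v] is still open; on the right the
positions inside it, where no cut was allowed, have become allowed cuts. *)
Lemma ribbon_dual s e u v d : signed_inverse s e -> (u < v)%N ->
  ribbon s u v d = ribbon e u u.+1 (nseq (v - u.+1) true ++ map negb d).
Proof.
move=> es; elim: d u v => [|x d IHd] u v lt_uv /=.
  by rewrite cats0 (ribbon_nseq_true_inv _ _ es) subnKC.
have nseqS l : nseq (v - u.+1) true ++ true :: l = nseq (v.+1 - u.+1) true ++ l.
  by rewrite nseq_catr subSn.
case: x => /=; last by rewrite nseqS IHd // ltnW.
rewrite !IHd ?ltnS ?(ltnW lt_uv) // subnn /= -nseqS.
apply/eqP; rewrite subr_eq addrC ribbon_cat size_nseq subnKC //.
by rewrite (ribbon_nseq_true_inv _ _ es) subnKC.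
Qed.

End RibbonSums.

(** * The cuts of a composition and of its conjugate *)

Section Words.

(** One letter per box, which is true at the first box of each part; deleting
the first letter leaves the cuts of I. *)
Definition word (I : seq nat) : seq bool :=
  flatten [seq true :: nseq i.-1 false | i <- I].

Lemma size_word I : 0%N \notin I -> size (word I) = sumn I.
Proof.
elim: I => //= i I IHI; rewrite inE negb_or => /andP[i0 I0].
by rewrite size_cat size_nseq IHI //; lia.
Qed.

(** Since cuts are allowed only at the ends U u of the parts, the sum over
boxes is a sum over parts in which all the cuts are allowed. *)
Lemma ribbon_word (R : nzRingType) (h : nat -> nat -> R) (U : nat -> nat)
    (I : seq nat) p q : 0%N \notin I ->
  (forall k, (k < size I)%N -> U (q + k).+1 = (U (q + k) + nth 0 I k)%N) ->
  ribbon h (U p) (U q) (word I) =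
  ribbon (fun u v => h (U u) (U v)) p q (nseq (size I) true).
Proof.
elim: I p q => //= i I IHI p q; rewrite inE negb_or => /andP[i0 I0] UI.
have Uq : U q.+1 = ((U q).+1 + i.-1)%N.
  by have := UI 0%N isT; rewrite addn0 /= => ->; lia.
have UI' k : (k < size I)%N -> U (q.+1 + k).+1 = (U (q.+1 + k) + nth 0 I k)%N.
  by move=> lt_k; rewrite addSnnS UI.
by rewrite !ribbon_nseq_false -Uq !IHI.
Qed.

Lemma ribbon_behead_word (R : nzRingType) (h : nat -> nat -> R) (I : seq nat) :
  is_composition I ->
  ribbon h 0 1 (behead (word I)) =
  ribbon (fun u v => h (sumn (take u I)) (sumn (take v I))) 0 1
    (nseq (size I).-1 true).
Proof.
case: I => // i I; rewrite /is_composition inE negb_or /= => /andP[i0 I0].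
pose U u := sumn (take u (i :: I)).
rewrite ribbon_nseq_false -(@ribbon_word _ _ U) //=.
  by rewrite /U /= take0 /= addn0; congr ribbon; lia.
move=> k lt_k; rewrite /U /= (take_nth 0%N) // -cats1 sumn_cat add0n /=; lia.
Qed.

Definition columns I := [seq column_height I c | c <- iota 0 (ribbon_width I)].

Lemma conjugateE I : conjugate I = rev (columns I).
Proof. by []. Qed.

Lemma in_ribbon_cons i I l c :
  in_ribbon (i :: I) l.+1 c = (i.-1 <= c)%N && in_ribbon I l (c - i.-1).
Proof.
rewrite /in_ribbon /row_start /= ltnS; set x := sumn _; set y := nth _ _ _.
case: (l < size I)%N; rewrite ?andbF //=.
by case: (leqP i.-1 c) => ?; apply/idP/idP; lia.
Qed.

Lemma column_height_cons i I c : (0 < i)%N ->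
  column_height (i :: I) c =
  ((c < i) + (if (i.-1 <= c)%N then column_height I (c - i.-1) else 0))%N.
Proof.
move=> i0; rewrite /column_height /=; congr (_ + _)%N.
rewrite -[1%N]/(1 + 0)%N iotaDl count_map (eq_count (a2 := fun l =>
  (i.-1 <= c)%N && in_ribbon I l (c - i.-1))); last first.
  by move=> l /=; rewrite add1n in_ribbon_cons.
by case: ifP => _ //=; rewrite count_pred0.
Qed.

Lemma ribbon_width_cons i I : ribbon_width (i :: I) = (i.-1 + ribbon_width I)%N.
Proof. by rewrite /ribbon_width /row_start /= addnS. Qed.

Lemma columns1 i : (0 < i)%N -> columns [:: i] = nseq i 1%N.
Proof.
move=> i0; rewrite /columns ribbon_width_cons addn1 prednK //.
apply: (@eq_from_nth _ 0%N) => [|c];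
  rewrite size_map size_iota ?size_nseq // => lt_c.
rewrite (nth_map 0%N) ?size_iota // nth_iota // column_height_cons // add0n.
by rewrite nth_nseq lt_c /column_height /=; case: ifP.
Qed.

(** A new first row adds one box on top of the first column, and columns of
height one to the left of it. *)
Lemma columns_cons i I : (0 < i)%N ->
  columns (i :: I) =
  nseq i.-1 1%N ++ (head 0%N (columns I)).+1 :: behead (columns I).
Proof.
move=> i0; rewrite /columns ribbon_width_cons iotaD map_cat; congr (_ ++ _).
  apply: (@eq_from_nth _ 0%N) => [|c];
    rewrite size_map size_iota ?size_nseq // => lt_c.
  rewrite (nth_map 0%N) ?size_iota // nth_iota // column_height_cons // add0n.
  by rewrite nth_nseq lt_c (leq_trans lt_c (leq_pred i)) ifN -?ltnNge.
rewrite addnC iotaDl -map_comp /ribbon_width /=.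
rewrite addn0 column_height_cons // leqnn subnn; congr (_ :: _); first by lia.
rewrite -[1%N]addn0 iotaDl -!map_comp; apply: eq_map => c /=.
rewrite column_height_cons // leq_addr addKn ltnNge; lia.
Qed.

Lemma columns_composition I : is_composition I -> is_composition (columns I).
Proof.
rewrite /is_composition; elim: I => // i I IHI.
rewrite inE negb_or => /and3P[_ i0 I0].
have [->|nI] := eqVneq I [::].
  rewrite columns1; last lia.
  by case: i i0 => //= i _; rewrite inE mem_nseq /= andbF.
rewrite columns_cons; last lia.
rewrite nI I0 in IHI; case/andP: (IHI isT) => _ c0.
have nz1 : 0%N \notin nseq i.-1 1%N by rewrite mem_nseq andbF.
case: (columns I) c0 => [|h c]; rewrite ?inE ?negb_or mem_cat negb_or nz1.
  by case: (nseq _ _).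
by case/andP=> _ c0; case: (nseq _ _).
Qed.

(** Going from a box of the ribbon to the next one, either the row or the column
changes, and never both. *)
Lemma word_columns I : is_composition I ->
  behead (word (columns I)) = map negb (behead (word I)).
Proof.
elim: I => // i I IHI; rewrite /is_composition inE negb_or => /and3P[_ i0 I0].
have i_gt0 : (0 < i)%N by lia.
have word1 k J : word (nseq k 1%N ++ J) = nseq k true ++ word J.
  by rewrite /word; elim: k => //= k ->.
have [->|nI] := eqVneq I [::].
  rewrite columns1 // -[nseq i _]cats0 word1 /= !cats0 map_nseq.
  by case: (i) i_gt0.
have cI : is_composition I by rewrite /is_composition nI.
move: (columns_composition cI) (IHI cI); rewrite columns_cons //.
case: (columns I) => // h c.
rewrite /is_composition inE negb_or /= => /andP[h0 _] eqw.
rewrite word1 /= map_cat map_nseq -/(word I).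
have -> : word I = true :: behead (word I) by case: (I) nI.
rewrite /= -eqw; case: h h0 {eqw} => // h _ /=.
case: i {i0} i_gt0 => //= i _.
by case: i => //= i; rewrite nseq_catr.
Qed.

End Words.

(** * Coefficients of double factorial series *)

Section Coefficients.

Variables (K : fieldType) (V : lmodType K).
Implicit Types (b : int -> K) (x y : K) (f g : nat -> V) (k n : nat).

(** The product (t - x) (f - f 0), which is again a series in 1 / t. *)
Definition step x f : nat -> V :=
  fun n => f n.+1 - x *: (if n is 0 then 0 else f n).

(** Each 1 / ((t - b_1) ... (t - b_k)) with k > 0 loses its first factor,
whereas [inv_dfact] is defined by adding a last factor. *)
Lemma step_dfseries b c :
  step (b 1) (dfseries b c) = dfseries (tau 1 b) (c \o succn).
Proof.
have inv_dfactS k : inv_dfact b k.+1 =1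
    seriesM (inv_linear (b 1)) (inv_dfact (tau 1 b) k).
  elim: k => [|k IHk] n.
    by rewrite /= series1M seriesM1.
  transitivity (seriesM (inv_dfact b k.+1) (inv_linear (b k.+2%:Z)) n) => //.
  rewrite (eq_seriesM IHk (frefl _)) -seriesMA; congr (seriesM _ _).
  by rewrite /= /tau; congr (seriesM _ (inv_linear (b _))); lia.
have lin x (g : nat -> K) n :
    seriesM (inv_linear x) g n.+1 = g n + x * seriesM (inv_linear x) g n.
  rewrite /seriesM big_ord_recl mul0r add0r big_ord_recl mul1r subn1 /=.
  congr (_ + _).
  rewrite [in RHS]big_ord_recl mul0r add0r mulr_sumr; apply: eq_bigr => i _.
  by rewrite /= exprS mulrA; congr (_ * g _); rewrite /bump /=; lia.
have invS k n :
    inv_dfact b k.+1 n.+1 - b 1 * inv_dfact b k.+1 n = inv_dfact (tau 1 b) k n.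
  by rewrite !inv_dfactS lin addrK.
apply: boolp.funext => n; rewrite /step /dfseries big_ord_recl.
have -> : inv_dfact b (ord0 : 'I_n.+2) n.+1 = 0 by [].
rewrite scale0r add0r.
set X := (if _ is _.+1 then _ else _).
have {X} -> : X = \sum_(k < n.+1) inv_dfact b k.+1 n *: c k.+1.
  rewrite /X [RHS]big_ord_recr /= -/(inv_dfact b n.+1) inv_dfact_tri //.
  rewrite ltn_eqF // scale0r addr0.
  case: n {X} => [|n]; first by rewrite big_ord0.
  by rewrite big_ord_recl scale0r add0r.
rewrite scaler_sumr -sumrB; apply: eq_bigr => k _.
by rewrite scalerA -scalerBl invS.
Qed.

Lemma dfcoef0 b f : dfcoef b f 0%N = f 0%N.
Proof. by rewrite -(dfseries0 b) dfcoefK. Qed.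

(** Removing c_0 from \sum_k c_k / ((t - b_1) ... (t - b_k)) and multiplying by
t - b_1 shifts both the coefficients and the parameters. *)
Lemma dfcoefS b f k : dfcoef b f k.+1 = dfcoef (tau 1 b) (step (b 1) f) k.
Proof.
have -> : f = dfseries b (dfcoef b f).
  by apply: boolp.funext => n; rewrite dfcoefK.
by rewrite step_dfseries !dfseriesK.
Qed.

Lemma dfcoef_morph b (phi : V -> V) f k :
  {morph phi : u v / u - v} -> (forall x, {morph phi : v / x *: v}) ->
  dfcoef b (phi \o f) k = phi (dfcoef b f k).
Proof.
move=> phiB phiZ; have phi0 : phi 0 = 0 by have := phiB 0 0; rewrite !subrr.
elim: k b f => [|k IHk] b f; first by rewrite !dfcoef0.
rewrite !dfcoefS -IHk; congr (dfcoef _ _ _); apply: boolp.funext => n.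
by rewrite /step /=; case: n => [|n] /=; rewrite phiB phiZ ?phi0.
Qed.

Lemma dfcoefD b f g k :
  dfcoef b (fun n => f n + g n) k = dfcoef b f k + dfcoef b g k.
Proof.
elim: k b f g => [|k IHk] b f g; first by rewrite !dfcoef0.
rewrite !dfcoefS -IHk; congr (dfcoef _ _ _); apply: boolp.funext => n.
rewrite /step; case: n => [|n]; rewrite ?scaler0 ?subr0 //.
by rewrite scalerDr opprD addrACA.
Qed.

(** When f stands for the series \sum_n f n * t ^- n.+1, this is the part of
(t - x) f without constant term. These operators commute, unlike the
operators [step x]. *)
Definition shift_sub x f : nat -> V := fun n => f n.+1 - x *: f n.

(** With the same reading of f, the coefficient of 1 / t in the product of f and
of the t - x, x in l. *)
Fixpoint residue (l : seq K) f : V :=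
  if l is x :: l' then residue l' (shift_sub x f) else f 0%N.

Lemma dfcoef_residue b f k :
  dfcoef b f k.+1 = residue [seq b i.+1%:Z | i <- iota 0 k] (f \o succn).
Proof.
elim: k b f => [|k IHk] b f.
  by rewrite dfcoefS dfcoef0 /step scaler0 subr0.
rewrite dfcoefS IHk /= (iotaDl 1 0) -map_comp.
congr (residue _ _); apply: eq_map => i /=; rewrite /tau; congr (b _); lia.
Qed.

Lemma residue_rcons l x f : residue (rcons l x) f = residue (x :: l) f.
Proof.
elim: l f => //= y l IHl f; rewrite IHl /=; congr (residue _ _).
apply: boolp.funext => n; rewrite /shift_sub !scalerBr !opprB !scalerA mulrC.
by rewrite addrACA [in RHS]addrACA; congr (_ + _); rewrite addrC.
Qed.

Lemma residue_rev l f : residue (rev l) f = residue l f.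
Proof.
by elim: l f => // x l IHl f; rewrite rev_cons residue_rcons /= IHl.
Qed.

(** The residue formula is symmetric in the parameters b_1, ..., b_(k-1). *)
Lemma dfcoef_rev b b' f k :
  (forall i j : nat, (0 < i)%N -> (0 < j)%N -> (i + j)%N = k ->
     b i%:Z = b' j%:Z) ->
  dfcoef b f k = dfcoef b' f k.
Proof.
case: k => [|k] bb'; first by rewrite !dfcoef0.
rewrite !dfcoef_residue -[LHS]residue_rev; congr (residue _ _).
apply: (@eq_from_nth _ 0) => [|i];
  rewrite size_rev !size_map size_iota // => lt_ik.
rewrite nth_rev ?size_map ?size_iota //.
rewrite !(nth_map 0%N) ?size_iota ?nth_iota //; try lia.
by apply: bb'; lia.
Qed.

End Coefficients.

Section Products.

Variables (K : fieldType) (R : algType K).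
Implicit Types (b : int -> K) (f g : nat -> R).

(** Replacing t by - t turns t - b_i into - (t + b_i). *)
Lemma dfcoefN b f k :
  dfcoef b (seriesN f) k = (-1) ^+ k * dfcoef (fun i => - b i) f k.
Proof.
elim: k b f => [|k IHk] b f; first by rewrite !dfcoef0 /seriesN.
rewrite !dfcoefS exprS mulN1r mulNr -IHk -(@dfcoef_morph _ _ _ -%R); last first.
- by move=> x v; rewrite scalerN.
- by move=> u v; rewrite opprD.
congr (dfcoef _ _ _); apply: boolp.funext => n /=.
rewrite /step /seriesN; case: n => [|n].
  by rewrite expr1 mul1r !scaler0 !subr0 mulN1r.
  by rewrite exprS mulN1r mulNr scaleNr opprK mulrDr opprD -scalerAr.
Qed.

(** In the w-th term of the expansion of f, the series g can be expanded with
the parameters that follow b_w. The proof by induction rests on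
[step x] being a twisted derivation:
(t - x) (f g - f_0 g_0) = f_0 (t - x) (g - g_0) + (t - x) (f - f_0) g. *)
Lemma dfcoefM b f g k :
  dfcoef b (seriesM f g) k =
  \sum_(i < k.+1) dfcoef b f i * dfcoef (tau i%:Z b) g (k - i).
Proof.
elim: k b f g => [|k IHk] b f g.
  by rewrite big_ord1 !dfcoef0 /seriesM big_ord1.
rewrite dfcoefS big_ord_recl dfcoef0 tau0 subn0 dfcoefS.
have -> : step (b 1) (seriesM f g) =
    (fun n => f 0%N * step (b 1) g n + seriesM (step (b 1) f) g n).
  apply: boolp.funext => n.
  rewrite /seriesM /step big_ord_recl subn0 mulrBr -!addrA.
  congr (_ + _); case: n => [|n].
    by rewrite !big_ord1 !scaler0 !subr0 mulr0 oppr0 add0r.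
  under [in RHS]eq_bigr do rewrite mulrBl.
  rewrite sumrB [in RHS]addrCA; congr (_ + _).
  rewrite big_ord_recl [X in _ = _ - X]big_ord_recl scaler0 mul0r add0r.
  rewrite scalerDr opprD.
  congr (- _ - _); first by rewrite subn0 scalerAr.
  by rewrite scaler_sumr; apply: eq_bigr => i _; rewrite scalerAl.
rewrite dfcoefD IHk; congr (_ + _).
  apply: (@dfcoef_morph _ _ _ ( *%R (f 0%N))) => [u v|x v].
    by rewrite mulrBr.
  by rewrite scalerAr.
apply: eq_bigr => i _; rewrite -dfcoefS /=; congr (_ * dfcoef _ _ _).
by rewrite /tau; apply: boolp.funext => j; congr (b _); rewrite /bump /=; lia.
Qed.

Lemma dfcoef_series1 b k : dfcoef b (@series1 R) k = (k == 0%N)%:R.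
Proof.
have -> : series1 R = dfseries b (series1 R); last by rewrite dfseriesK.
apply: boolp.funext => n; rewrite /dfseries big_ord_recl /= scaler_nat.
rewrite big1 ?addr0 => [|i _]; last by rewrite scaler0.
by rewrite /series1 mulr1n; case: n.
Qed.

End Products.

(** * The entries attached to a block of boxes *)

Section Duality.

Variables (K : fieldType) (R : algType K) (a : int -> K) (N : nat).
Variable f : nat -> R.

(** The coefficients of f with respect to the parameters
a_(u+2-N), ..., a_(v+1-N); attaching a_(i+1-N) to box i makes these the
parameters of the boxes u + 1, ..., v. *)
Definition boxS u v : R := dfcoef (tau (- (N%:Z - u%:Z - 1)) a) f (v - u).
Definition boxL u v : R :=
  dfcoef (tau (N%:Z - v%:Z) (hat a)) (seriesN (seriesV f)) (v - u).

(** The parameters of [boxL u v] are, up to sign, those of the boxes v - 1,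
v - 2, ..., u; only the first v - u - 1 of them matter, and they are the ones
used by [boxS u v], in the opposite order. *)
Lemma boxL_dfcoef u v : (u <= v)%N ->
  boxL u v = (-1) ^+ (v - u) *
    dfcoef (tau (- (N%:Z - u%:Z - 1)) a) (seriesV f) (v - u).
Proof.
move=> le_uv; rewrite /boxL dfcoefN; congr (_ * _).
apply: dfcoef_rev => i j i0 j0 ij.
by rewrite /tau /hat opprK; congr (a _); lia.
Qed.

Lemma box_signed_inverse : f 0%N = 1 -> signed_inverse boxS boxL.
Proof.
move=> f0; split=> [v|v|u v lt_uv].
- by rewrite /boxS subnn dfcoef0.
- by rewrite boxL_dfcoef // subnn mul1r dfcoef0 seriesV0.
pose b := tau (- (N%:Z - u%:Z - 1)) a.
transitivity (dfcoef b (series1 R) (v - u)); last first.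
  by rewrite dfcoef_series1 subn_eq0 leqNgt lt_uv.
have <- : seriesM (seriesV f) f = series1 R.
  by apply: boolp.funext => n; rewrite seriesVM.
rewrite dfcoefM; apply: eq_bigr => i _.
rewrite boxL_dfcoef ?leq_addr // addKn -mulrA signrMK.
congr (_ * _); rewrite /boxS subnDA; congr (dfcoef _ _ _).
by apply: boolp.funext => j; rewrite /b /tau; congr (a _); lia.
Qed.

End Duality.

(** * Quasideterminants of Hessenberg matrices *)

Section Hessenberg.
Variable R : nzRingType.
Implicit Types (h : nat -> nat -> R) (z : nat -> R).

Lemma sum_hessenberg_row h z n p : (p <= n)%N ->
  \sum_(q < n)
     (if (p <= q)%N then h p q else if p == q.+1 then 1 else 0) * z q =
  \sum_(p <= q < n) h p q * z q + (if p is p'.+1 then z p' else 0).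
Proof.
move=> le_pn; rewrite -(big_mkord xpredT (fun q => (if (p <= q)%N then h p q
  else if p == q.+1 then 1 else 0) * z q)) (big_cat_nat (n := p)) //= addrC.
congr (_ + _); first by apply: eq_big_nat => q /andP[-> _].
case: p le_pn => [|p] _; first by rewrite big_geq.
rewrite big_nat_recr //= ltnn eqxx mul1r big_nat_cond big1 ?add0r // => q.
rewrite andbT => /= lt_qp.
by rewrite ltnNge ltnW ?ltnS //= eqSS gtn_eqF ?mul0r //; lia.
Qed.

(** The column (y 1, ..., y n) solves the linear system of the minor, since row
p of that system, p > 0, reads y p + \sum_(p <= q < n) h p q * y q.+1 = h p n.
The expression in row 0 is the quasideterminant. *)
Lemma quasidet_hessenberg h (n : nat) y :
  (forall p, (p <= n)%N ->
     y p = h p n - \sum_(p <= q < n) h p q * y q.+1) ->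
  quasidet ord0 ord_max (hessenberg n h) = y 0%N.
Proof.
move=> y_eq; rewrite /quasidet; set H := hessenberg n h.
have rowH (p : 'I_n.+1) : \sum_(q < n) H p (widen_ord (leqnSn n) q) * y q.+1 =
    H p ord_max - y p + (if p == 0 :> nat then 0 else y p).
  under eq_bigr do rewrite mxE.
  rewrite (sum_hessenberg_row _ (y \o succn)) ?mxE /=; last by rewrite -ltnS.
  have le_pn : (p <= n)%N by rewrite -ltnS.
  have /eqP := y_eq p le_pn; rewrite eq_sym subr_eq le_pn => /eqP ->.
  by rewrite [y p + _]addrC addrK; case: (p : nat).
have widenE (q : 'I_n) : lift ord_max q = widen_ord (leqnSn n) q.
  by apply: val_inj; rewrite /= /bump leqNgt ltn_ord.
set M := row' _ _.
have [_ M'M] := hessenberg_minor_inv n h : is_mxinv M (mxinv M).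
have -> : col ord_max (row' ord0 H) = M *m \col_q y q.+1.
  apply/matrixP => i j; rewrite !mxE.
  have := rowH (lift ord0 i); rewrite mxE /= subrK => <-.
  by apply: eq_bigr => q _; rewrite !mxE widenE.
rewrite -mulmxA (mulmxA (mxinv M)) M'M mul1mx.
set c := (\col_q _).
have -> : (row ord0 (col' ord_max H) *m c) 0 0 = H ord0 ord_max - y 0%N.
  have /= := rowH ord0; rewrite addr0 => <-; rewrite mxE.
  by apply: eq_bigr => q _; rewrite !mxE widenE.
by rewrite subKr.
Qed.

(** The recursion of [quasidet_hessenberg] is the expansion of [ribbon] along
its first block, up to signs. *)
Lemma quasidet_ribbon h (n : nat) :
  (-1) ^+ n * quasidet ord0 ord_max (hessenberg n h) =
  ribbon (fun u v => h u v.-1) 0 1 (nseq n true).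
Proof.
(* y p is the quasideterminant of the lower right block of rows p, ..., n. *)
pose y p := (-1) ^+ (n - p) *
  ribbon (fun u v => h u v.-1) p p.+1 (nseq (n - p) true).
rewrite (@quasidet_hessenberg _ _ y) => [|p le_pn].
  by rewrite /y subn0 signrMK.
rewrite /y ribbon_nseq_true mulrDr addrC signrMK addSn /= subnKC //.
congr (_ + _); rewrite mulr_sumr -sumrN (big_addn 0 n p) big_mkord.
apply: eq_bigr => -[i /= lt_i] _.
rewrite addSn [(p + i)%N]addnC.
have -> : (n - p - i.+1 = n - (i + p).+1)%N by lia.
have -> : (n - p = (n - (i + p).+1) + i.+1)%N by lia.
rewrite exprD exprS mulN1r mulrN mulNr -mulrA signrMK.
by rewrite mulrA [in RHS]mulrA commr_sign.
Qed.

End Hessenberg.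

Lemma sum_nth_take I p q :
  (\sum_(p <= i < q) nth 0 I i = sumn (take q I) - sumn (take p I))%N.
Proof.
have take_sum n : sumn (take n I) = (\sum_(0 <= i < n) nth 0 I i)%N.
  elim: n => [|n IHn]; first by rewrite take0 big_geq.
  rewrite big_nat_recr //= -IHn; case: (ltnP n (size I)) => [lt|le].
    by rewrite (take_nth 0%N) // sumn_rcons.
  by rewrite !take_oversize ?nth_default ?addn0 //; lia.
rewrite !take_sum; case: (leqP p q) => [le|lt].
  by rewrite (big_cat_nat (m := 0) (n := p) (p := q)) //= addKn.
rewrite big_geq ?(ltnW lt) //.
by rewrite (big_cat_nat (m := 0) (n := q) (p := p)) ?(ltnW lt) //=; lia.
Qed.

(** * The duality *)

Lemma shift_signed_inverse (K : fieldType) (a : int -> K) N :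
  signed_inverse (fun u v => Sshift a (N%:Z - u%:Z - 1) (v - u))
                 (fun u v => Lambda_shift a (N%:Z - v%:Z) (v - u)).
Proof.
have lambdaE : lambda a = seriesN (seriesV (sigma a)).
  by apply: boolp.funext => n; apply: dfcoefK.
rewrite /Lambda_shift lambdaE; apply: (box_signed_inverse a N).
exact: dfseries0.
Qed.

Unset Implicit Arguments.

Theorem proposition30 (K : fieldType) (charK : [pchar K] =i pred0)
  (a : int -> K) (I J : seq nat) (hI : is_composition I)
  (hJ : J = conjugate I) :
  ribbonS a I ((last 0%N I)%:Z - 1) =
  (-1) ^+ (size J).-1 * quasidet ord0 ord_max (LambdaC a J).
Proof.
pose N := sumn I; pose L := columns I.
have hL : is_composition L := columns_composition hI.
have wL : behead (word L) = map negb (behead (word I)) := word_columns hI.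
have nzI : 0%N \notin I by case/andP: hI.
have nzL : 0%N \notin L by case/andP: hL.
have posI : (0 < size I)%N by case: (I) hI.
have posL : (0 < size L)%N by case: (L) hL.
have sum_pos X : 0%N \notin X -> (0 < size X)%N -> (0 < sumn X)%N.
  by case: X => //= x X; rewrite inE; lia.
have sumL : sumn L = N.
  have /(congr1 size) := wL; rewrite size_map !size_behead !size_word //.
  by have := sum_pos _ nzI posI; have := sum_pos _ nzL posL; rewrite /N; lia.
have sum_take X k : (sumn (take k X) <= sumn X)%N.
  by rewrite -{2}(cat_take_drop k X) sumn_cat leq_addr.
have mono_take X x y : (x <= y)%N -> (sumn (take x X) <= sumn (take y X))%N.
  by move=> le_xy; rewrite -(subnKC le_xy) takeD sumn_cat leq_addr.
rewrite /ribbonS /ribbonS_multi /LambdaC !quasidet_ribbon.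
pose s u v := Sshift a (N%:Z - u%:Z - 1) (v - u).
transitivity (ribbon s 0 1 (behead (word I))).
  rewrite (ribbon_behead_word _ hI); apply: eq_ribbon => // x y.
  rewrite size_nseq => /andP[lt_xy le_y].
  have y0 : (0 < y)%N by lia.
  rewrite prednK // !sum_nth_take /s.
  (* The last part supplies what the sums of the shifts leave out, and the
     shift of the block (u, v] becomes N - u - 1. *)
  have NE : N = (sumn (take (size I).-1 I) + last 0 I)%N.
    rewrite /N; case/lastP: (I) posI => // s' z _.
    rewrite size_rcons /= last_rcons -cats1 take_size_cat //.
    by rewrite sumn_cat /= addn0.
  set s1 := _%:Z + _; have -> // : s1 = N%:Z - (sumn (take x I))%:Z - 1.
  by have := mono_take I x (size I).-1; rewrite /s1; lia.
rewrite (ribbon_dual _ (shift_signed_inverse a N)) // -wL /=.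
rewrite (ribbon_behead_word _ hL).
have -> : size J = size L by rewrite hJ conjugateE size_rev.
apply: eq_ribbon => // x y; rewrite size_nseq => /andP[lt_xy le_y].
(* J lists the columns from right to left, so its sums are complements of those
   of L, and the shift of the block (u, v] becomes N - v. *)
have takeJ k : (k <= size L)%N ->
    sumn (take (size L - k) J) = (N - sumn (take k L))%N.
  move=> le_k; rewrite hJ conjugateE take_rev subKn // sumn_rev -sumL.
  have /(congr1 sumn) := cat_take_drop k L.
  by rewrite sumn_cat => <-; rewrite addKn.
rewrite !sum_nth_take take0 /= subn0.
have -> : ((size L).-1 - y.-1 = size L - y)%N by lia.
have -> : ((size L).-1 - x).+1 = (size L - x)%N by lia.
rewrite !takeJ; try lia.
have := mono_take L x y (ltnW lt_xy); have := sum_take L y.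
rewrite sumL => le1 le2.
rewrite subzn //.
by have -> : (sumn (take y L) - sumn (take x L) =
  N - sumn (take x L) - (N - sumn (take y L)))%N by lia.
Qed.
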